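(* Let $(M,g)$ be an $n$-dimensional pseudo-Riemannian manifold and $f$ a smooth function on $M$. Let $\lambda$ be a smooth function on $M$ such that $(\nabla^{df},Q^g,\mathrm{grad}_g(f),\lambda)$ is a gradient almost soliton, i.e. $\nabla^{df}\mathrm{grad}_g(f)+Q^g=\lambda I$. Then $$|\mathrm{Hess}^g(f)|_g^2+\frac{4(n-1)}{n}|\mathrm{grad}_g(f)|_g^4-\frac1n(\Delta^g(f))^2-\frac4n|\mathrm{grad}_g(f)|_g^2\Delta^g(f)+4\,\mathrm{Hess}^g(f)(\mathrm{grad}_g(f),\mathrm{grad}_g(f))\le|\mathrm{Ric}^g|_g^2$$ and $$|\mathrm{Ric}^g|_g^2\le|\mathrm{Hess}^g(f)|_g^2-\frac{4(n-1)}{n}|\mathrm{grad}_g(f)|_g^4+\frac1n(\mathrm{scal}^{(g,\nabla^g)})^2+\frac4n|\mathrm{grad}_g(f)|_g^2\,\mathrm{scal}^{(g,\nabla^g)}-4\,\mathrm{Ric}^g(\mathrm{grad}_g(f),\mathrm{grad}_g(f)).$$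
   Context: $\nabla^g$ is the Levi-Civita connection of $g$, $\mathrm{Ric}^g$ its Ricci tensor, $\mathrm{scal}^{(g,\nabla^g)}$ the scalar curvature of $g$, and $Q^g$ the Ricci operator, $g(Q^gX,Y)=\mathrm{Ric}^g(X,Y)$. For a smooth function $f$ on $M$, $\nabla^{df}$ is the affine connection $\nabla^{df}_XY=\nabla^g_XY+df(X)Y+df(Y)X+g(X,Y)\,\mathrm{grad}_g(f)$, $\nabla^{df}\mathrm{grad}_g(f)$ denotes the endomorphism $X\mapsto\nabla^{df}_X\mathrm{grad}_g(f)$, and $I$ is the identity. $\mathrm{Hess}^g(f)(X,Y)=g(\nabla^g_X\mathrm{grad}_g(f),Y)$ and $\Delta^g(f)$ is its $g$-trace. $|\cdot|_g^2$ denotes the (possibly indefinite) squared norm on $(0,2)$-tensors induced by $g$; for vectors $|\xi|_g^2=g(\xi,\xi)$ and $|\xi|_g^4=(g(\xi,\xi))^2$. *)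

(* Defs.v *)
From HB Require Import structures.
From mathcomp Require Import all_boot all_order all_algebra.
From mathcomp Require Import all_classical all_reals all_analysis.

Set Implicit Arguments.
Unset Strict Implicit.
Unset Printing Implicit Defensive.

Import Order.TTheory GRing.Theory Num.Theory.
Import numFieldNormedType.Exports.

Local Open Scope classical_set_scope.
Local Open Scope ring_scope.

Section SmoothManifolds.
Context {R : realType} {n : nat}.

Implicit Types (U : set 'rV[R]_n) (f : 'rV[R]_n -> R).

(* Meaningful for U open: the pointwise conditions then only involve the
   values of f on U. *)
Fixpoint Ck (k : nat) U f : Prop :=
  match k with
  | 0 => forall x, U x -> {for x, continuous f}
  | k'.+1 => (forall x, U x -> differentiable f x) /\
             forall v, Ck k' U (fun x => 'D_v f x)
  end.

Definition smooth_on U f : Prop := forall k, Ck k U f.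

Context {M : topologicalType}.

(* A chart is a homeomorphism cmap from the open set cdom onto the open set
   cmap @` cdom, with inverse cinv; cmap and cinv are total functions whose
   values off cdom and cmap @` cdom are irrelevant. *)
Record chart := Chart {
  cdom : set M;
  cmap : M -> 'rV[R]_n;
  cinv : 'rV[R]_n -> M;
  cdom_open : open cdom;
  cimg_open : open (cmap @` cdom);
  cmapK : {in cdom, cancel cmap cinv};
  cmap_continuous : forall q, cdom q -> {for q, continuous cmap};
  cinv_continuous :
    forall x, (cmap @` cdom) x -> {for x, continuous cinv} }.

Definition compatible (c c' : chart) : Prop :=
  forall j : 'I_n, smooth_on (cmap c @` (cdom c `&` cdom c'))
                             (fun x => cmap c' (cinv c x) 0 j).

(* Every point p comes with a preferred chart chart_at p around it, chosen
   once and for all in the atlas. *)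
Record smooth_manifold := SmoothManifold {
  manifold_hausdorff : hausdorff_space M;
  manifold_second_countable : @second_countable M;
  atlas : set chart;
  chart_at : M -> chart;
  atlas_compatible :
    forall c c', atlas c -> atlas c' -> compatible c c';
  chart_at_atlas : forall p, atlas (chart_at p);
  chart_at_dom : forall p, cdom (chart_at p) p }.

End SmoothManifolds.

Arguments chart R n M : clear implicits.
Arguments smooth_manifold R n M : clear implicits.

Section Geometry.
Context {R : realType} {n : nat} {M : topologicalType}.
Variable S : smooth_manifold R n M.

Local Notation c_ := (chart_at S).

(* The tangent space T_pM is identified with R^n by means of the preferred
   chart at p: the row vector v stands for \sum_i v_i d/dx_i at p, where the
   x_i are the coordinates of chart_at p.  A vector field is then a function
   X with X p in T_pM, and a field of bilinear forms is a function g whose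
   value g p is the Gram matrix of a form on T_pM. *)
Definition vfield : Type := M -> 'rV[R]_n.

(* f is smooth on a neighbourhood of p. *)
Definition smooth_at (f : M -> R) (p : M) : Prop :=
  exists2 U : set 'rV[R]_n, open_nbhs (cmap (c_ p) p) U &
    smooth_on U (f \o cinv (c_ p)).

Definition smooth_fun (f : M -> R) : Prop := forall p, smooth_at f p.

(* df_p(v) *)
Definition dfun (f : M -> R) (p : M) (v : 'rV[R]_n) : R :=
  'd (f \o cinv (c_ p)) (cmap (c_ p) p) v.

(* Components, in the chart at p, of the vector v of T_qM, for q in the
   domain of the chart at p. *)
Definition components (p q : M) (v : 'rV[R]_n) : 'rV[R]_n :=
  'd (cmap (c_ p) \o cinv (c_ q)) (cmap (c_ q) q) v.

(* The local vector field whose components in the chart at p are constantly v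
   (its values off the domain of that chart are irrelevant). *)
Definition const_vfield (p : M) (v : 'rV[R]_n) : vfield :=
  fun q => 'd (cmap (c_ q) \o cinv (c_ p)) (cmap (c_ p) q) v.

Definition smooth_vfield_at (X : vfield) (p : M) : Prop :=
  forall j : 'I_n, smooth_at (fun q => components p q (X q) 0 j) p.

(* [X, Y], the vector field acting on functions by f |-> X(Yf) - Y(Xf); its
   i-th component at p is its value on the i-th coordinate function of the
   chart at p. *)
Definition lie_bracket (X Y : vfield) : vfield := fun p =>
  \row_i (let x_i := fun q => cmap (c_ p) q 0 i in
          dfun (fun q => dfun x_i q (Y q)) p (X p) -
          dfun (fun q => dfun x_i q (X q)) p (Y p)).

(* Metrics *)

Definition inner (g : M -> 'M[R]_n) (p : M) (v w : 'rV[R]_n) : R :=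
  (v *m g p *m w^T) 0 0.

Record pseudo_riemannian (g : M -> 'M[R]_n) : Prop := PseudoRiemannian {
  metric_sym : forall p v w, inner g p v w = inner g p w v;
  metric_nondegenerate : forall p, g p \in unitmx;
  metric_smooth : forall p X Y, smooth_vfield_at X p -> smooth_vfield_at Y p ->
    smooth_at (fun q => inner g q (X q) (Y q)) p }.

(* g(grad f, v) = df(v) *)
Definition grad (g : M -> 'M[R]_n) (f : M -> R) : vfield :=
  fun p => (\row_i dfun f p 'e_i) *m invmx (g p).

(* The covariant components T(e_i, e_j) of a bilinear form T on T_pM. *)
Definition form_mx (T : 'rV[R]_n -> 'rV[R]_n -> R) : 'M[R]_n :=
  \matrix_(i, j) T 'e_i 'e_j.

(* \sum_(i, j) g^ij T_ij *)
Definition gtrace (g : M -> 'M[R]_n) (p : M)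
    (T : 'rV[R]_n -> 'rV[R]_n -> R) : R :=
  \sum_i \sum_j invmx (g p) i j * form_mx T i j.

(* |T|_g^2 = \sum_(i, j, k, l) g^ik g^jl T_ij T_kl *)
Definition gnorm2 (g : M -> 'M[R]_n) (p : M)
    (T : 'rV[R]_n -> 'rV[R]_n -> R) : R :=
  \sum_i \sum_j \sum_k \sum_l
    invmx (g p) i k * invmx (g p) j l * form_mx T i j * form_mx T k l.

(* Connections *)

(* nabla Y p v is the derivative at p of the vector field Y in the direction
   v of T_pM.  A connection acts on vector fields defined near a point: vector
   fields are total functions here, so its laws at p are required of those
   that are smooth near p.  Applied to indicator functions of neighbourhoods
   of p, the Leibniz rule makes nabla Y p depend on the germ of Y at p only. *)
Definition connection : Type := vfield -> forall p : M, 'rV[R]_n -> 'rV[R]_n.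

Definition cov (nabla : connection) (X Y : vfield) : vfield :=
  fun p => nabla Y p (X p).

Record affine_connection (nabla : connection) : Prop := AffineConnection {
  connection_linear : forall Y p, linear (nabla Y p);
  connection_add : forall p v Y Z,
    smooth_vfield_at Y p -> smooth_vfield_at Z p ->
    nabla (fun q => Y q + Z q) p v = nabla Y p v + nabla Z p v;
  connection_leibniz : forall p v f Y,
    smooth_at f p -> smooth_vfield_at Y p ->
    nabla (fun q => f q *: Y q) p v = f p *: nabla Y p v + dfun f p v *: Y p;
  connection_smooth : forall p X Y,
    smooth_vfield_at X p -> smooth_vfield_at Y p ->
    smooth_vfield_at (cov nabla X Y) p }.

Record levi_civita (g : M -> 'M[R]_n) (nabla : connection) : Prop :=
  LeviCivita {
  levi_civita_affine : affine_connection nabla;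
  levi_civita_torsion_free : forall p X Y,
    smooth_vfield_at X p -> smooth_vfield_at Y p ->
    cov nabla X Y p - cov nabla Y X p = lie_bracket X Y p;
  levi_civita_metric : forall p v Y Z,
    smooth_vfield_at Y p -> smooth_vfield_at Z p ->
    dfun (fun q => inner g q (Y q) (Z q)) p v =
      inner g p (nabla Y p v) (Z p) + inner g p (Y p) (nabla Z p v) }.

(* Curvature *)

Definition riemann (nabla : connection) (X Y Z : vfield) : vfield := fun p =>
  cov nabla X (cov nabla Y Z) p - cov nabla Y (cov nabla X Z) p
  - cov nabla (lie_bracket X Y) Z p.

(* R_p(u, v)w, computed on extensions of u, v, w to vector fields. *)
Definition riemann_at (nabla : connection) (p : M) (u v w : 'rV[R]_n) :
    'rV[R]_n :=
  riemann nabla (const_vfield p u) (const_vfield p v) (const_vfield p w) p.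

(* Ric(v, w) = tr (z |-> R(z, v)w) *)
Definition ricci (nabla : connection) (p : M) (v w : 'rV[R]_n) : R :=
  \tr (lin1_mx (fun z => riemann_at nabla p z v w)).

Definition scal (g : M -> 'M[R]_n) (nabla : connection) (p : M) : R :=
  gtrace g p (ricci nabla p).

Definition ricci_operator (g : M -> 'M[R]_n) (nabla : connection)
    (Q : forall p : M, 'rV[R]_n -> 'rV[R]_n) : Prop :=
  forall p v w, inner g p (Q p v) w = ricci nabla p v w.

(* Hessian and Laplacian *)

Definition hess (g : M -> 'M[R]_n) (nabla : connection) (f : M -> R)
    (p : M) (v w : 'rV[R]_n) : R :=
  inner g p (nabla (grad g f) p v) w.

Definition laplacian (g : M -> 'M[R]_n) (nabla : connection) (f : M -> R)
    (p : M) : R :=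
  gtrace g p (hess g nabla f p).

(* Solitons *)

(* nabla^df *)
Definition df_connection (g : M -> 'M[R]_n) (nabla : connection)
    (f : M -> R) : connection := fun Y p v =>
  nabla Y p v + dfun f p v *: Y p + dfun f p (Y p) *: v
  + inner g p v (Y p) *: grad g f p.

(* nabla xi + J = lambda I, as endomorphisms of each T_pM *)
Definition almost_soliton (nabla : connection)
    (J : forall p : M, 'rV[R]_n -> 'rV[R]_n) (xi : vfield)
    (lambda : M -> R) : Prop :=
  forall p v, nabla xi p v + J p v = lambda p *: v.

End Geometry.

(* Main.v *)
(** The soliton equation, paired with [g], reads
    [Ric + Hess + 2 df (x) df = (lambda - |xi|^2) g], with [xi = grad f].  Put
    [mu = lambda - |xi|^2]; the [g]-trace is [scal + Delta + 2 |xi|^2 = n mu].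
    Computing [|Ric|^2] from [Ric = mu g - Hess - 2 df (x) df], the two sides of
    the first inequality differ by [scal^2 / n]; exchanging the roles of [Ric]
    and [Hess], those of the second one differ by [Delta^2 / n]. *)

Require Import Defs.
From HB Require Import structures.
From mathcomp Require Import all_boot all_order all_algebra ring lra.
From mathcomp Require Import all_classical all_reals all_analysis.

Import Order.TTheory GRing.Theory Num.Theory.
Import numFieldNormedType.Exports.

Local Open Scope ring_scope.

Lemma trmx11 (R : Type) (A : 'M[R]_1) : A^T = A.
Proof. by apply/matrixP => i j; rewrite mxE !ord1. Qed.

(** The laws of a connection give linearity as a bare proposition. Packing it into a linear map
    makes [mul_rV_lin1] applicable, so that the covariant derivative at a point becomes a matrix. *)
Lemma linear_mul_lin1_mx (R : comNzRingType) (m n : nat)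
    (L : 'rV[R]_m -> 'rV[R]_n) (hL : linear L) (v : 'rV[R]_m) :
  L v = v *m lin1_mx L.
Proof.
pose L' : {linear 'rV[R]_m -> 'rV[R]_n} :=
  HB.pack L (GRing.isLinear.Build R _ _ *:%R L hL).
by rewrite -[L]/(L' : _ -> _) mul_rV_lin1.
Qed.

Section MatrixForms.
Context {R : realType} {n : nat}.

Lemma form_mx_mul (A : 'M[R]_n) :
  form_mx (fun v w => (v *m A *m w^T) 0 0) = A.
Proof.
by apply/matrixP => i j; rewrite mxE -rowE trmx_delta -colE !mxE.
Qed.

(** For [P] the inverse metric this is the induced inner product on (0,2)-tensors, the sum of P_ki
    P_jl S_ij T_kl. *)
Definition form_dot (P S T : 'M[R]_n) : R := \tr (P *m S *m P *m T^T).

Lemma form_dotC (P S T : 'M[R]_n) (hP : P^T = P) :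
  form_dot P S T = form_dot P T S.
Proof.
rewrite /form_dot -[LHS]mxtrace_tr !trmx_mul trmxK hP.
by rewrite !mulmxA [LHS]mxtrace_mulC !mulmxA.
Qed.

Lemma form_dotDr (P S T U : 'M[R]_n) :
  form_dot P S (T + U) = form_dot P S T + form_dot P S U.
Proof. by rewrite /form_dot linearD mulmxDr linearD. Qed.

Lemma form_dotZr (P S T : 'M[R]_n) (a : R) :
  form_dot P S (a *: T) = a * form_dot P S T.
Proof. by rewrite /form_dot linearZ -scalemxAr linearZ. Qed.

Lemma form_dot_metric (G T : 'M[R]_n) (hG : G \in unitmx) (hs : G^T = G) :
  form_dot (invmx G) T G = \tr (invmx G *m T).
Proof. by rewrite /form_dot hs mulmxKV. Qed.

(** By cyclicity of the trace, pairing with the rank-one form of the covector [d] evaluates [T] on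
    two copies of [d *m P], the vector dual to [d]. *)
Lemma form_dot_square (P T : 'M[R]_n) (d : 'rV[R]_n) (hP : P^T = P) :
  form_dot P T (d^T *m d) = (d *m P *m T *m (d *m P)^T) 0 0.
Proof.
rewrite /form_dot !trmx_mul trmxK hP mulmxA mxtrace_mulC.
by rewrite !mulmxA trace_mx11.
Qed.

Lemma mxtrace_square (P : 'M[R]_n) (d : 'rV[R]_n) :
  \tr (P *m (d^T *m d)) = (d *m P *m d^T) 0 0.
Proof. by rewrite mulmxA mxtrace_mulC mulmxA trace_mx11. Qed.

Lemma gnorm2E (M : topologicalType) (g : M -> 'M[R]_n) (p : M)
    (T : 'rV[R]_n -> 'rV[R]_n -> R) (hs : (invmx (g p))^T = invmx (g p)) :
  gnorm2 g p T = form_dot (invmx (g p)) (form_mx T) (form_mx T).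
Proof.
rewrite /gnorm2 /form_dot; move: (form_mx T) (invmx (g p)) hs => A P hP.
have hPE i j : P i j = P j i by rewrite -[in LHS]hP mxE.
rewrite /mxtrace.
under [RHS]eq_bigr => k _.
  rewrite mxE.
  under eq_bigr => l _.
    rewrite !mxE mulr_suml.
    under eq_bigr => j _ do rewrite mxE !mulr_suml.
    over.
  over.
(* The trace is now a sum over k, l, j, i in this order; the exchanges bring the left side to the
   same order. *)
under [LHS]eq_bigr => i _ do rewrite exchange_big.
rewrite [LHS]exchange_big; apply: eq_bigr => k _.
under [LHS]eq_bigr => i _ do rewrite exchange_big.
rewrite [LHS]exchange_big; apply: eq_bigr => l _.
rewrite [LHS]exchange_big; apply: eq_bigr => j _; apply: eq_bigr => i _.
by rewrite (hPE i k); ring.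
Qed.

Lemma gtraceE (M : topologicalType) (g : M -> 'M[R]_n) (p : M)
    (T : 'rV[R]_n -> 'rV[R]_n -> R) (hs : (invmx (g p))^T = invmx (g p)) :
  gtrace g p T = \tr (invmx (g p) *m form_mx T).
Proof.
rewrite /gtrace /mxtrace exchange_big; apply: eq_bigr => j _.
rewrite mxE; apply: eq_bigr => i _.
by rewrite -[in LHS]hs mxE.
Qed.

Section Decomposition.
(** [K] and [H] stand for Ric and Hess in either order, [d] for df, [xi] for the gradient and [N]
    for its squared norm. *)
Variables (G H K : 'M[R]_n) (d : 'rV[R]_n) (mu : R).
Hypotheses (hG : G \in unitmx) (hs : G^T = G).
Hypothesis decomposition : K + H + 2 *: (d^T *m d) = mu *: G.

Let P := invmx G.
Let xi := d *m P.
Let N := (xi *m G *m xi^T) 0 0.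

Let hP : P^T = P. Proof. by rewrite /P trmx_inv hs. Qed.

Let xi_dE : (xi *m d^T) 0 0 = N.
Proof. by rewrite /N /xi mulmxKV // trmx_mul hP mulmxA. Qed.

Lemma decomposition_trace :
  \tr (P *m K) + \tr (P *m H) + 2 * N = mu * n%:R.
Proof.
rewrite -xi_dE -mxtrace_square -mxtraceZ scalemxAr -!mxtraceD -!mulmxDr.
by rewrite decomposition -scalemxAr mulVmx // mxtraceZ mxtrace1.
Qed.

(** Solve the decomposition for [K] and expand bilinearly: pairings with [G] are traces, and
    pairings with [d^T *m d] are values at [xi]. *)
Lemma decomposition_norm :
  form_dot P K K = form_dot P H H + 4 * N ^+ 2 + mu ^+ 2 * n%:R
    - 2 * mu * \tr (P *m H) - 4 * mu * N + 4 * (xi *m H *m xi^T) 0 0.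
Proof.
have -> : K = mu *: G + (-1 *: H + -2 *: (d^T *m d)).
  apply/matrixP => i j; have /matrixP/(_ i j) := decomposition.
  by move: (d^T *m d) => D; rewrite !mxE => ?; lra.
set D := d^T *m d; set Z := _ + _.
have e T : form_dot P T Z =
    mu * \tr (P *m T) - form_dot P T H - 2 * form_dot P T D.
  by rewrite /Z !form_dotDr !form_dotZr form_dot_metric //; ring.
have trD : \tr (P *m D) = N by rewrite /D mxtrace_square xi_dE.
have trG : \tr (P *m G) = n%:R by rewrite mulVmx // mxtrace1.
have HD : form_dot P H D = (xi *m H *m xi^T) 0 0 by rewrite form_dot_square.
have DD : form_dot P D D = N ^+ 2.
  rewrite form_dot_square // -/xi /D !mulmxA.
  rewrite -[_ *m d *m _]mulmxA [xi *m d^T]mx11_scalar xi_dE mul_scalar_mx mxE.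
  by rewrite -[d *m _]trmx11 trmx_mul trmxK xi_dE expr2.
have trZ : \tr (P *m Z) = mu * n%:R - \tr (P *m H) - 2 * N.
  rewrite /Z !mulmxDr -!scalemxAr !mxtraceD !mxtraceZ trG trD; ring.
(* [e] expands a [Z] in the second argument only; symmetry moves the remaining ones there. *)
rewrite e (form_dotC P Z H hP) (form_dotC P Z D hP) !e trZ trD.
by rewrite (form_dotC P D H hP) HD DD; ring.
Qed.

End Decomposition.
End MatrixForms.

Theorem proposition3p15 (R : realType) (n : nat) (hn : (0 < n)%N)
    (M : topologicalType) (S : smooth_manifold R n M)
    (g : M -> 'M[R]_n) (hg : pseudo_riemannian S g)
    (nabla : connection) (hnabla : levi_civita S g nabla)
    (Q : forall p : M, 'rV[R]_n -> 'rV[R]_n)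
    (hQ : ricci_operator S g nabla Q)
    (f : M -> R) (hf : smooth_fun S f)
    (lambda : M -> R) (hlambda : smooth_fun S lambda)
    (hsol : almost_soliton (df_connection S g nabla f) Q (grad S g f) lambda) :
  forall p : M,
    let xi := grad S g f p in
    let Hess := hess S g nabla f p in
    let Delta := laplacian S g nabla f p in
    let Ric := ricci S nabla p in
    let scal := scal S g nabla p in
    let norm2_xi := inner g p xi xi in
    (gnorm2 g p Hess + 4 * (n%:R - 1) / n%:R * norm2_xi ^+ 2
       - 1 / n%:R * Delta ^+ 2 - 4 / n%:R * norm2_xi * Delta
       + 4 * Hess xi xi
     <= gnorm2 g p Ric) /\
    (gnorm2 g p Ric
     <= gnorm2 g p Hess - 4 * (n%:R - 1) / n%:R * norm2_xi ^+ 2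
        + 1 / n%:R * scal ^+ 2 + 4 / n%:R * norm2_xi * scal
        - 4 * Ric xi xi).
Proof.
move=> p xi Hess Delta Ric sc N.
have hGu := metric_nondegenerate hg p.
have hGs : (g p)^T = g p.
  apply/matrixP => i j; rewrite mxE.
  have := Defs.metric_sym hg p 'e_j 'e_i.
  by rewrite /inner -!rowE !trmx_delta -!colE !mxE.
have hPs : (invmx (g p))^T = invmx (g p) by rewrite trmx_inv hGs.
pose d : 'rV[R]_n := \row_i dfun S f p 'e_i.
have dE v : dfun S f p v = (v *m d^T) 0 0.
  rewrite /dfun [v in LHS]row_sum_delta linear_sum /= mxE.
  by apply: eq_bigr => i _; rewrite linearZ !mxE.
have xiE : xi = d *m invmx (g p) by [].
have xiG v : inner g p v xi = (v *m d^T) 0 0.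
  by rewrite /inner xiE trmx_mul hPs mulmxA mulmxK.
pose A := lin1_mx (nabla (grad S g f) p).
have AE v : nabla (grad S g f) p v = v *m A.
  exact/linear_mul_lin1_mx/(connection_linear (levi_civita_affine hnabla)).
pose H := A *m g p.
have HessE : Hess = fun v w => (v *m H *m w^T) 0 0.
  apply/funext => v; apply/funext => w.
  by rewrite /Hess /hess /inner AE /H !mulmxA.
pose mu := lambda p - N.
(* The soliton equation solved for Ric, which is reached through [Q] without computing any
   curvature. *)
pose K := mu *: g p - H - 2 *: (d^T *m d).
have RicE : Ric = fun v w => (v *m K *m w^T) 0 0.
  apply/funext => v; apply/funext => w.
  rewrite /Ric -hQ.
  have -> : Q p v = lambda p *: v - df_connection S g nabla f (grad S g f) p v.
    by rewrite -(hsol p v) addrC addKr.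
  (* The terms df(v) xi and g(v, xi) xi coincide, whence the factor 2; the term df(xi) v = N v turns
     [lambda] into [mu]. *)
  rewrite /df_connection -/xi.
  rewrite AE !dE xiG.
  have -> : (xi *m d^T) 0 0 = N by rewrite -xiG.
  rewrite -[_ *: grad S g f p]mul_scalar_mx -mx11_scalar -/xi xiE /inner /K /H /mu !mulmxA.
  rewrite !(mulmxBr, mulmxBl, mulmxDr, mulmxDl) -!scalemxAr -!scalemxAl !mulmxA.
  rewrite mulNmx (mulmxKV hGu).
  move: (_ *m d *m w^T) (v *m A *m _ *m w^T) (v *m g p *m w^T) => B C D.
  by rewrite !mxE; ring.
have dec : K + H + 2 *: (d^T *m d) = mu *: g p by rewrite /K addrAC subrK subrK.
have dec' : H + K + 2 *: (d^T *m d) = mu *: g p by rewrite [H + K]addrC.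
have tr := decomposition_trace _ _ _ _ _ hGu hGs dec.
have nK := decomposition_norm _ _ _ _ _ hGu hGs dec.
have nH := decomposition_norm _ _ _ _ _ hGu hGs dec'.
have DeltaE : Delta = \tr (invmx (g p) *m H).
  by rewrite /Delta /laplacian gtraceE // -/Hess HessE form_mx_mul.
have scE : sc = \tr (invmx (g p) *m K).
  by rewrite /sc /scal gtraceE // -/Ric RicE form_mx_mul.
rewrite !gnorm2E // HessE RicE !form_mx_mul.
rewrite -xiE -/(inner g p xi xi) -/N -DeltaE -?scE in tr nK nH *.
have n0 : (n%:R : R) != 0 by rewrite pnatr_eq0 -lt0n.
have sq (x : R) : 0 <= x ^+ 2 / n%:R by rewrite mulr_ge0 ?sqr_ge0 ?invr_ge0.
(* For a = Delta + 2N this value gives n mu^2 - 2 mu a = (sc^2 - a^2) / n, so in the first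
   difference all but sc^2 / n cancels; the second is the same with [sc] and [Delta] exchanged. *)
have muE : mu = (sc + Delta + 2 * N) / n%:R by rewrite tr mulfK.
split; rewrite -subr_ge0.
- rewrite [leRHS](_ : _ = sc ^+ 2 / n%:R) ?sq //.
  by rewrite nK muE; field.
- rewrite [leRHS](_ : _ = Delta ^+ 2 / n%:R) ?sq //.
  by rewrite nH muE; field.
Qed.
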